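(* Let $(\Delta,[\![\ ,\ ]\!])$ be a regular cleft extension on a differential graded algebra $\Omega=\Omega(A)$ of classical type, with interior product $\mathfrak j$, metric inner product $(\ ,\ )$ and covariant derivative $\nabla_\omega\eta=\frac12[\![\omega,\eta]\!]$ ($\omega\in\Omega^1$, $\eta\in\Omega$). Then $(\ ,\ )$ is symmetric; the interior product is a graded derivation, i.e. for each $\zeta\in\Omega^1$ the map $\omega\mapsto\mathfrak j_\omega(\zeta)$ is a graded derivation of degree $-1$ of $\Omega$; the covariant derivative has symmetric part $$\nabla_\omega\eta+\nabla_\eta\omega=\mathfrak j_{\mathrm d\omega}(\eta)+\mathfrak j_{\mathrm d\eta}(\omega)+\mathrm d(\omega,\eta),\qquad\forall\omega,\eta\in\Omega^1;$$ and its torsion and metric-compatibility tensor obey $$T(\zeta,\omega)(\eta)+T(\zeta,\eta)(\omega)=C_\zeta(\omega,\eta),\qquad\forall\omega,\eta,\zeta\in\Omega^1.$$ If $(\ ,\ )$ is invertible with metric $g=g^1\otimes g^2$, the Laplace–Beltrami operator $\Delta_{LB}=\nabla_{g^1}\nabla_{g^2}-\nabla_{\nabla_{g^1}g^2}$ obeys $$L_{\Delta_{LB}}(a,\omega)=2\nabla_{\mathrm da}\omega,\qquad a\in A,\ \omega\in\Omega,$$ so that $\mathrm{Ricci}_\Delta$ is defined.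
   Context: $A$ is a unital algebra over a field $k$ of characteristic $\ne2$. A DGA on $A$ is an associative graded algebra $\Omega=\oplus_{n\ge0}\Omega^n$ with $\Omega^0=A$ and a graded derivation $\mathrm d$ of degree $1$, $\mathrm d^2=0$. It is standard if $\Omega^1$ is spanned by elements $a\,\mathrm db$ and $\Omega$ is generated by degrees $0,1$; of classical type if it is standard, graded-commutative and equal to the tensor algebra of $\Omega^1$ over $A$ modulo the relations of antisymmetry. For a degree $0$ map $B$, $L_B(\omega,\eta)=B(\omega\eta)-(B\omega)\eta-\omega B\eta$. A (central extension) cocycle on $\Omega$ is a pair of a degree $0$ linear map $\Delta$ and a degree $-1$ bilinear map $[\![\ ,\ ]\!]$ on $\Omega$ with $[\Delta,\mathrm d]=0$ and, for all $\omega,\eta,\zeta\in\Omega$, $[\![\omega\eta,\zeta]\!]+[\![\omega,\eta]\!]\zeta=[\![\omega,\eta\zeta]\!]+(-1)^{|\omega|}\omega[\![\eta,\zeta]\!]$ and $L_\Delta(\omega,\eta)=\mathrm d[\![\omega,\eta]\!]+[\![\mathrm d\omega,\eta]\!]+(-1)^{|\omega|}[\![\omega,\mathrm d\eta]\!]$. It is a cleft extension if $[\![a,\ ]\!]=0$ for all $a\in A$. A cleft extension is regular if $\mathfrak j_\omega(a\,\mathrm db)=\frac12[\![\omega a,b]\!]$ is a well-defined map $\mathfrak j:\Omega^i\otimes_A\Omega^1\to\Omega^{i-1}$ for all $i$ (the interior product); the metric inner product is $(\omega,\zeta)=\mathfrak j_\omega(\zeta)$ for $\omega,\zeta\in\Omega^1$.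 With $\mathfrak i_\zeta\omega:=\mathfrak j_\omega(\zeta)$ for $\zeta\in\Omega^1$, the torsion and metric-compatibility tensors are, for $\omega,\eta,\zeta\in\Omega^1$, $T(\omega,\eta)(\zeta)=(\omega,\nabla_\eta\zeta)-(\eta,\nabla_\omega\zeta)-\mathfrak i_\omega\mathfrak i_\eta\mathrm d\zeta$ and $C_\omega(\eta,\zeta)=(\omega,\mathrm d(\eta,\zeta))-(\nabla_\omega\eta,\zeta)-(\eta,\nabla_\omega\zeta)$. $(\ ,\ )$ is invertible with metric $g=g^1\otimes g^2\in\Omega^1\otimes_A\Omega^1$ (sum understood) if $(\omega,g^1)g^2=\omega=g^1(g^2,\omega)$ for all $\omega\in\Omega^1$. $\mathrm{Ricci}_\Delta$ denotes $g^1\otimes_A(\Delta_{LB}-\Delta)(g^2)\in\Omega^1\otimes_A\Omega^1$.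
   Formalization: Ricci_Δ need not be independent of how g is written as a sum of tensors (e.g. A=k[x], Δf=f''+f'); the formal statement proves L_{Δ_LB}=L_Δ on A×Ω and that Ricci_Δ is well defined if and only if (Δ_LB a−Δa)ω=0 for all a in A, ω in Ω^1. *)

(* Defs.v *)
From HB Require Import structures.
From mathcomp Require Import all_boot all_algebra.
From mathcomp Require Import boolp freeg.

Set Implicit Arguments.
Unset Strict Implicit.
Unset Printing Implicit Defensive.

Import GRing.Theory.
Local Open Scope ring_scope.

(* The abelian group generated by [X] subject to the relators [R]: the free    *)
(* abelian group on [X] modulo the subgroup generated by [R].                  *)
Section PresentedGroup.
Variables (X : choiceType) (R : {freeg X} -> Prop).

Definition relator_span : {pred {freeg X}} := fun z =>
  `[< forall S : zmodClosed {freeg X},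
        (forall r, R r -> r \in S) -> z \in S >].

Lemma relator_span_zmod : zmod_closed relator_span.
Proof.
split; first by apply/asboolP => S _; exact: rpred0.
move=> x y /asboolP hx /asboolP hy; apply/asboolP => S RS.
by apply: rpredB; [exact: hx | exact: hy].
Qed.

HB.instance Definition _ :=
  GRing.isZmodClosed.Build {freeg X} relator_span relator_span_zmod.

Definition presented : Type := {ideal_quot relator_span}.
HB.instance Definition _ := GRing.Zmodule.on presented.

Definition generator (x : X) : presented :=
  \pi_({ideal_quot relator_span})%qT << x >>.

End PresentedGroup.

(* [M (x)_A N] for a right action of [A] on [M] and a left action on [N]. *)
Section Tensor.
Variables (A : Type) (M N : zmodType).
Variables (ract : M -> A -> M) (lact : A -> N -> N).

Inductive tensor_relator : {freeg (M * N)%type} -> Prop :=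
| TensorDl x x' y :
    tensor_relator (<< (x + x', y) >> - << (x, y) >> - << (x', y) >>)
| TensorDr x y y' :
    tensor_relator (<< (x, y + y') >> - << (x, y) >> - << (x, y') >>)
| TensorA x a y :
    tensor_relator (<< (ract x a, y) >> - << (x, lact a y) >>).

End Tensor.

(* A differential graded algebra with [A] its degree 0 part. The grading is    *)
(* internal: [degree n] is the subspace Omega^n of Omega.                      *)
Record dga (k : fieldType) := DGA {
  dga_algebra :> algType k;
  degree : nat -> submodClosed dga_algebra;
  degree_total : forall x : dga_algebra,
    exists (n : nat) (c : nat -> dga_algebra),
      (forall i, c i \in degree i) /\ x = \sum_(i < n) c i;
  degree_direct : forall (n : nat) (c : nat -> dga_algebra),
    (forall i, c i \in degree i) -> \sum_(i < n) c i = 0 ->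
    forall i, (i < n)%N -> c i = 0;
  degree1 : 1 \in degree 0;
  degreeM : forall m n x y,
    x \in degree m -> y \in degree n -> x * y \in degree (m + n);
  diff : {linear dga_algebra -> dga_algebra};
  degree_diff : forall n x, x \in degree n -> diff x \in degree n.+1;
  diffM : forall n x y, x \in degree n ->
    diff (x * y) = diff x * y + (-1) ^+ n * (x * diff y);
  diff_diff : forall x, diff (diff x) = 0
}.
Arguments degree {k} _ _.
Arguments diff {k} _.

Section Forms.
Variables (k : fieldType) (Om : dga k).
Implicit Types (m n : nat).

Definition dform n : Type := {x : Om | x \in degree Om n}.
HB.instance Definition _ n := SubChoice.on (dform n).
HB.instance Definition _ n := [SubChoice_isSubLmodule of dform n by <:].

Definition dform_val n (w : dform n) : Om := val w.
Coercion dform_val : dform >-> GRing.Algebra.sort.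

Lemma dform_one_subproof : 1 \in degree Om 0. Proof. exact: degree1. Qed.
Definition dform_one : dform 0 := Sub 1 dform_one_subproof.

Lemma dform_rmul_subproof n (w : dform n) (a : dform 0) :
  (w : Om) * (a : Om) \in degree Om n.
Proof. by rewrite -[n in degree _ n]addn0; apply: degreeM; exact: valP. Qed.
Definition dform_rmul n (w : dform n) (a : dform 0) : dform n :=
  Sub ((w : Om) * (a : Om)) (dform_rmul_subproof w a).

Lemma dform_lmul_subproof n (a : dform 0) (w : dform n) :
  (a : Om) * (w : Om) \in degree Om n.
Proof. by rewrite -[n in degree _ n]add0n; apply: degreeM; exact: valP. Qed.
Definition dform_lmul n (a : dform 0) (w : dform n) : dform n :=
  Sub ((a : Om) * (w : Om)) (dform_lmul_subproof a w).

(* Omega^m (x)_A Omega^n *)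
Definition tensor_forms m n : Type :=
  presented (tensor_relator (@dform_rmul m) (@dform_lmul n)).
HB.instance Definition _ m n := GRing.Zmodule.on (tensor_forms m n).

Definition tens m n (w : dform m) (z : dform n) : tensor_forms m n :=
  generator _ (w, z).

(* An element [sum_i w_i (x) z_i] given by the list of the pairs [(w_i, z_i)]. *)
Definition tens_sum m n (s : seq (dform m * dform n)) : tensor_forms m n :=
  \sum_(p <- s) tens p.1 p.2.

Definition standard : Prop :=
  (forall w : dform 1, exists s : seq (dform 0 * dform 0),
     (w : Om) = \sum_(p <- s) (p.1 : Om) * diff Om (p.2 : Om)) /\
  (forall S : subalgClosed Om,
     (forall a : dform 0, (a : Om) \in S) ->
     (forall w : dform 1, (w : Om) \in S) -> forall x : Om, x \in S).

Definition graded_commutative : Prop :=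
  forall m n (x : dform m) (y : dform n),
    (x : Om) * (y : Om) = (-1) ^+ (m * n) * ((y : Om) * (x : Om)).

(* The tensor algebra of the [A]-bimodule Omega^1, presented by words in       *)
(* letters from [A] (on the left of the sum) and Omega^1 (on the right), the   *)
(* product being concatenation. The words [u], [v] around each relation        *)
(* generate the two-sided ideal.                                               *)
Definition letter : Type := (dform 0 + dform 1)%type.
HB.instance Definition _ := Choice.on letter.
Definition letter_val (l : letter) : Om :=
  match l with inl a => (a : Om) | inr w => (w : Om) end.

Inductive tensor_algebra_relator : {freeg (seq letter)} -> Prop :=
| TAddA u v (a b : dform 0) : tensor_algebra_relator
    (<< u ++ inl (a + b) :: v >> - << u ++ inl a :: v >> - << u ++ inl b :: v >>)
| TOneA u v : tensor_algebra_relator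
    (<< u ++ inl dform_one :: v >> - << u ++ v >>)
| TMulA u v (a b : dform 0) : tensor_algebra_relator
    (<< u ++ inl (dform_rmul a b) :: v >> - << u ++ [:: inl a, inl b & v] >>)
| TAddM u v (w z : dform 1) : tensor_algebra_relator
    (<< u ++ inr (w + z) :: v >> - << u ++ inr w :: v >> - << u ++ inr z :: v >>)
| TLmulM u v (a : dform 0) (w : dform 1) : tensor_algebra_relator
    (<< u ++ inr (dform_lmul a w) :: v >> - << u ++ [:: inl a, inr w & v] >>)
| TRmulM u v (w : dform 1) (a : dform 0) : tensor_algebra_relator
    (<< u ++ inr (dform_rmul w a) :: v >> - << u ++ [:: inr w, inl a & v] >>).

Inductive antisymmetry_relator : {freeg (seq letter)} -> Prop :=
| Antisymmetry u v (w z : dform 1) : antisymmetry_relator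
    (<< u ++ [:: inr w, inr z & v] >> + << u ++ [:: inr z, inr w & v] >>).

Definition antisymmetric_tensor_algebra : Type :=
  presented (fun r => tensor_algebra_relator r \/ antisymmetry_relator r).
HB.instance Definition _ := GRing.Zmodule.on antisymmetric_tensor_algebra.

Definition classical_type : Prop :=
  [/\ standard, graded_commutative &
    exists phi : {additive antisymmetric_tensor_algebra -> Om},
      (forall s : seq letter,
         phi (generator _ s) = \prod_(l <- s) letter_val l) /\
      bijective phi].

(* Membership in Omega^(n-1), where Omega^(-1) = 0. *)
Definition degree_pred n (x : Om) : bool :=
  if n is m.+1 then x \in degree Om m else x == 0.

(* L_B(x, y) = B(xy) - (Bx)y - x(By) *)
Definition leibniz_defect (B : Om -> Om) (x y : Om) : Om :=
  B (x * y) - B x * y - x * B y.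

Definition graded_derivation_pred (D : Om -> Om) : Prop :=
  [/\ linear D,
      forall n x, x \in degree Om n -> degree_pred n (D x) &
      forall n x y, x \in degree Om n ->
        D (x * y) = D x * y + (-1) ^+ n * (x * D y)].

Record cocycle := Cocycle {
  laplace : {linear Om -> Om};
  bracket : {bilinear Om -> Om -> Om};
  degree_laplace : forall n x,
    x \in degree Om n -> laplace x \in degree Om n;
  degree_bracket : forall m n x y,
    x \in degree Om m -> y \in degree Om n ->
    degree_pred (m + n) (bracket x y);
  laplace_diff : forall x, laplace (diff Om x) = diff Om (laplace x);
  bracketM : forall m x y z, x \in degree Om m ->
    bracket (x * y) z + bracket x y * z =
    bracket x (y * z) + (-1) ^+ m * (x * bracket y z);
  laplaceM : forall m x y, x \in degree Om m ->
    leibniz_defect laplace x y =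
    diff Om (bracket x y) + bracket (diff Om x) y
      + (-1) ^+ m * bracket x (diff Om y)
}.

Variable E : cocycle.

Definition cleft : Prop :=
  forall (a : dform 0) (x : Om), bracket E (a : Om) x = 0.

(* [j w z] is j_w(z); only its values for [z] in Omega^1 are constrained. *)
Definition interior_product (j : Om -> Om -> Om) : Prop :=
  [/\ forall z : dform 1, linear (fun w : Om => j w z),
      forall n, exists J : {additive tensor_forms n 1 -> Om},
        (forall t, degree_pred n (J t)) /\
        (forall (w : dform n) (z : dform 1), J (tens w z) = j w z) &
      forall n (w : dform n) (a b : dform 0),
        j w ((a : Om) * diff Om (b : Om)) =
        2^-1 *: bracket E ((w : Om) * (a : Om)) (b : Om)].

Definition regular : Prop := exists j, interior_product j.

Definition nabla (w x : Om) : Om := 2^-1 *: bracket E w x.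

Section Metric.
Variable j : Om -> Om -> Om.

(* T(w, e)(z) *)
Definition torsion (w e z : Om) : Om :=
  j w (nabla e z) - j e (nabla w z) - j (j (diff Om z) e) w.

(* C_w(e, z) *)
Definition metric_compat (w e z : Om) : Om :=
  j w (diff Om (j e z)) - j (nabla w e) z - j e (nabla w z).

Definition invertible_with_metric (g : tensor_forms 1 1) : Prop :=
  exists2 s : seq (dform 1 * dform 1), tens_sum s = g &
    forall w : dform 1,
      \sum_(p <- s) j w p.1 * (p.2 : Om) = (w : Om) /\
      \sum_(p <- s) (p.1 : Om) * j p.2 w = (w : Om).

End Metric.

Definition laplace_beltrami (s : seq (dform 1 * dform 1)) (x : Om) : Om :=
  \sum_(p <- s) (nabla p.1 (nabla p.2 x) - nabla (nabla p.1 p.2) x).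

Lemma nabla_degree n (w x : Om) :
  w \in degree Om 1 -> x \in degree Om n -> nabla w x \in degree Om n.
Proof. by move=> hw hx; apply: rpredZ; exact: (degree_bracket E hw hx). Qed.

Lemma ricci_subproof s (z : dform 1) :
  laplace_beltrami s z - laplace E (z : Om) \in degree Om 1.
Proof.
rewrite /laplace_beltrami -scaleN1r; apply: rpredD; last first.
  by apply: rpredZ; apply: degree_laplace; exact: valP.
apply: rpred_sum => p _; rewrite -scaleN1r; apply: rpredD.
  by do 2![apply: nabla_degree; first exact: valP]; exact: valP.
apply: rpredZ; apply: nabla_degree; last exact: valP.
by apply: nabla_degree; exact: valP.
Qed.

Definition ricci (s : seq (dform 1 * dform 1)) : tensor_forms 1 1 :=
  \sum_(p <- s) tens p.1 (Sub (laplace_beltrami s p.2 - laplace E (p.2 : Om))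
                              (ricci_subproof s p.2) : dform 1).

(* [g1 (x) (Delta_LB - Delta)(g2)] does not depend on the way in which [g] is  *)
(* written as a sum of tensors [g1 (x) g2]. This does not follow from the      *)
(* cocycle axioms alone: they are preserved when the Lie derivative along a    *)
(* vector field [v] is added to Delta with the bracket unchanged, which        *)
(* changes Delta_LB - Delta by an operator that is not [A]-linear.             *)
Definition ricci_defined (g : tensor_forms 1 1) : Prop :=
  exists r : tensor_forms 1 1,
    forall s : seq (dform 1 * dform 1), tens_sum s = g -> ricci s = r.

End Forms.

Arguments dform {k} Om n.
Arguments tensor_forms {k} Om m n.

(* Main.v *)
(** On exact forms everything is read off the cocycle equations: [(da, db)] is
    half of the bracket of [da] with [b], that is [L_Delta(a, b)/2], symmetric
    because [A] is commutative, and evaluating [Delta] on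
    [d(ab) = a db + b da] gives the symmetric part of [nabla]. Both sides of
    each identity transform in the same way under multiplication by
    functions, so the general case follows as [Omega^1] is
    spanned by the [a db]. The torsion identity is the symmetric part paired
    with a third form.
    The Hessian [nabla_w nabla_z - nabla_(nabla_w z)] is balanced over [A] in
    [(w, z)], so [Delta_LB] depends on [g] only; contracting its Leibniz rule
    with [g] gives [L_(Delta_LB)(a, x) = 2 nabla_(da) x = L_Delta(a, x)]. Hence
    [D = Delta_LB - Delta] satisfies [D(a z) = a D(z) + D(a) z], and Ricci is
    well defined exactly when [D(a) z = 0]: adding the trivial tensor
    [w a (x) z - w (x) a z] to [g] changes [g1 (x) D(g2)] by [- w (x) D(a) z],
    and contracting with the inner product and [g] recovers [D(a) z]. *)
Require Import Defs.
From HB Require Import structures.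
From mathcomp Require Import all_boot all_algebra.
From mathcomp Require Import boolp freeg.

Set Implicit Arguments.
Unset Strict Implicit.
Unset Printing Implicit Defensive.

Import GRing.Theory.
Local Open Scope ring_scope.

Local Notation "M ^z" := (zmodule M) (format "M ^z") : type_scope.

(** * Equality of sums of generators in a presented group *)

Section PresentedGroupLift.
Variables (X : choiceType) (R : {freeg X} -> Prop) (V : zmodType) (f : X -> V).

(** The kernel of the additive extension of [f]; [V] is seen as a module over the integers because
    [fglift] takes values in modules. Being a closed subgroup, it can serve as the [S] of
    [relator_span]. *)
Definition fgker : {pred {freeg X}} := fun z => fglift (f : X -> V^z) z == 0.

Lemma fgker_zmod : zmod_closed fgker.
Proof.
split=> [|x y /eqP fx0 /eqP fy0]; apply/eqP.
  by have := lift_is_additive (f : X -> V^z) 0 0; rewrite !subrr.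
by rewrite (lift_is_additive (f : X -> V^z)) fx0 fy0 subrr.
Qed.

HB.instance Definition _ := GRing.isZmodClosed.Build {freeg X} fgker fgker_zmod.

Lemma fgliftU (x : X) : fglift (f : X -> V^z) << x >> = f x.
Proof. by rewrite liftU scale1r. Qed.

Lemma fgliftB (x y : {freeg X}) :
  fglift (f : X -> V^z) (x - y) = fglift (f : X -> V^z) x - fglift (f : X -> V^z) y.
Proof. exact: lift_is_additive. Qed.

Lemma fglift_sum (s : seq X) :
  fglift (f : X -> V^z) (\sum_(x <- s) << x >>) = \sum_(x <- s) f x.
Proof.
pose F : {freeg X} -> V^z := fglift (f : X -> V^z).
pose M := GRing.isZmodMorphism.Build _ _ F (lift_is_additive _).
pose G : {additive {freeg X} -> V^z} := HB.pack F M.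
by rewrite -[LHS]/(G _) raddf_sum; apply: eq_bigr => x _; exact: fgliftU.
Qed.

Lemma eq_presented (x y : {freeg X}) : x - y \in relator_span R ->
  \pi_({ideal_quot (relator_span R)})%qT x = \pi_({ideal_quot (relator_span R)})%qT y.
Proof. by rewrite Quotient.idealrBE => /eqP. Qed.

Lemma pi_sum_generator (s : seq X) :
  \sum_(x <- s) generator R x =
  \pi_({ideal_quot (relator_span R)})%qT (\sum_(x <- s) << x >>).
Proof. by rewrite raddf_sum. Qed.

(** Equal classes differ by an element of [relator_span], which lies in every subgroup containing
    the relators, hence in [fgker]. *)
Lemma presented_sum_eq (s t : seq X) :
    (forall r, R r -> r \in fgker) ->
    \sum_(x <- s) generator R x = \sum_(x <- t) generator R x ->
  \sum_(x <- s) f x = \sum_(x <- t) f x.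
Proof.
move=> Rf; rewrite !pi_sum_generator => /eqP; rewrite -Quotient.idealrBE.
move=> /asboolP/(_ fgker Rf)/eqP.
by rewrite fgliftB !fglift_sum => /eqP; rewrite subr_eq0 => /eqP.
Qed.

End PresentedGroupLift.

(** * Tensor products of forms over functions *)

Section TensorForms.
Variables (k : fieldType) (Om : dga k) (m n : nat).
Implicit Types (w : dform Om m) (z : dform Om n) (a : dform Om 0).

Lemma relator_in (X : choiceType) (R : {freeg X} -> Prop) r :
  R r -> r \in relator_span R.
Proof. by move=> Rr; apply/asboolP => S; exact. Qed.

Lemma tensDl w w' z : tens (w + w') z = tens w z + tens w' z.
Proof.
rewrite /tens /generator -!raddfD; apply: eq_presented; apply: relator_in.
by rewrite opprD addrA; exact: TensorDl.
Qed.

Lemma tensDr w z z' : tens w (z + z') = tens w z + tens w z'.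
Proof.
rewrite /tens /generator -!raddfD; apply: eq_presented; apply: relator_in.
by rewrite opprD addrA; exact: TensorDr.
Qed.

Lemma tensA w a z : tens (dform_rmul w a) z = tens w (dform_lmul a z).
Proof. by apply: eq_presented; apply: relator_in; exact: TensorA. Qed.

Lemma tensNl w z : tens (- w) z = - tens w z.
Proof.
have tens0 : tens (0 : dform Om m) z = 0.
  by apply: (addrI (tens (0 : dform Om m) z)); rewrite -tensDl !addr0.
by apply: (addrI (tens w z)); rewrite -tensDl !subrr.
Qed.

(** The universal property of the tensor product: the lift of [f] kills the three kinds of relator.
    It makes expressions in [g1], [g2] independent of how [g] is written as a sum. *)
Lemma balanced_sum_eq (V : zmodType) (f : dform Om m -> dform Om n -> V)
    (s t : seq (dform Om m * dform Om n)) :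
    (forall w w' z, f (w + w') z = f w z + f w' z) ->
    (forall w z z', f w (z + z') = f w z + f w z') ->
    (forall w a z, f (dform_rmul w a) z = f w (dform_lmul a z)) ->
  tens_sum s = tens_sum t -> \sum_(p <- s) f p.1 p.2 = \sum_(p <- t) f p.1 p.2.
Proof.
move=> fDl fDr fA st.
have sumE (u : seq (dform Om m * dform Om n)) :
    tens_sum u = \sum_(x <- u) generator _ x.
  by apply: eq_bigr => -[].
rewrite !sumE in st; apply: (presented_sum_eq _ st) => r.
case=> [w w' z|w z z'|w a z]; apply/eqP; rewrite !fgliftB !fgliftU /=.
- by rewrite fDl addrAC addrK subrr.
- by rewrite fDr addrAC addrK subrr.
- by rewrite fA subrr.
Qed.

End TensorForms.

(** * Reduction to homogeneous elements and to forms [a * diff Om b] *)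

Section DifferentialForms.
Variables (k : fieldType) (Om : dga k).
Implicit Types (n : nat) (a b c w x y z : Om).

Lemma degree_ind (P : Om -> Prop) :
    (forall n x, x \in degree Om n -> P x) ->
    (forall x y, P x -> P y -> P (x + y)) ->
  forall x, P x.
Proof.
move=> Pdeg PD x; have [n [c [degc ->]]] := degree_total x.
apply: big_ind => [|//|i _]; first exact: (Pdeg 0 _ (rpred0 _)).
exact: Pdeg (degc i).
Qed.

(** The summands keep their degrees in the additive step, since the second argument of [j] is only
    constrained on 1-forms. *)
Lemma form1_ind (P : Om -> Prop) : standard Om ->
    (forall a b, a \in degree Om 0 -> b \in degree Om 0 -> P (a * diff Om b)) ->
    (forall x y, x \in degree Om 1 -> y \in degree Om 1 ->
       P x -> P y -> P (x + y)) ->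
  forall w, w \in degree Om 1 -> P w.
Proof.
move=> [spanned _] Pexact PD w degw.
have [s defw] := spanned (Sub w degw); rewrite -[w]/(dform_val (Sub w degw)) defw.
suff [] : let y := \sum_(p <- s) (p.1 : Om) * diff Om (p.2 : Om) in
    y \in degree Om 1 /\ P y by [].
apply: (big_ind (fun y => y \in degree Om 1 /\ P y)) =>
  [|x y [degx Px] [degy Py]|[a b] _ /=].
(* The empty sum falls under the first case as [0 * diff Om 0]. *)
- by split; [exact: rpred0 | rewrite -(mul0r (diff Om 0)); apply: Pexact; exact: rpred0].
- by split; [exact: rpredD | exact: PD].
have [dega degb] : dform_val a \in degree Om 0 /\ dform_val b \in degree Om 0.
  by split; exact: valP.
by split; [apply: (degreeM dega (degree_diff degb)) | exact: Pexact].
Qed.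

Lemma degree0_central a x : graded_commutative Om ->
  a \in degree Om 0 -> a * x = x * a.
Proof.
move=> gc dega; elim/degree_ind: x => [n x degx|x y ax ay].
  by have := gc 0%N n (Sub a dega) (Sub x degx); rewrite mul0n expr0 mul1r.
by rewrite mulrDr mulrDl ax ay.
Qed.

End DifferentialForms.

(** * Leibniz rules for the bracket, the interior product and the covariant derivative *)

Section CleftExtension.
Variables (k : fieldType) (Om : dga k) (E : cocycle Om) (j : Om -> Om -> Om).
Hypotheses (k2 : 2%N \notin [pchar k]) (std : standard Om).
Hypotheses (gc : graded_commutative Om) (cleftE : cleft E).
Hypothesis jE : interior_product E j.
Implicit Types (n : nat) (a b c u v w x y z : Om).

Lemma two_half x : 2 *: (2^-1 *: x) = x.
Proof. by rewrite scalerA divff ?scale1r. Qed.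

Lemma bracket0 a x : a \in degree Om 0 -> bracket E a x = 0.
Proof. by move=> dega; exact: (cleftE (Sub a dega)). Qed.

(** In the cocycle equation for [a], [x], [y] the two brackets with first argument [a] vanish. *)
Lemma bracket_scalel a x y : a \in degree Om 0 ->
  bracket E (a * x) y = a * bracket E x y.
Proof.
move=> dega; have := bracketM E x y dega.
by rewrite expr0 mul1r !(bracket0 _ dega) mul0r addr0 add0r.
Qed.

Lemma nablaDl v w x : nabla E (v + w) x = nabla E v x + nabla E w x.
Proof. by rewrite /nabla linearDl scalerDr. Qed.

Lemma nablaDr w x y : nabla E w (x + y) = nabla E w x + nabla E w y.
Proof. by rewrite /nabla linearDr scalerDr. Qed.

Lemma nabla_scalel a w x : a \in degree Om 0 ->
  nabla E (a * w) x = a * nabla E w x.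
Proof. by move=> dega; rewrite /nabla bracket_scalel // scalerAr. Qed.

Lemma interiorDl x y z : z \in degree Om 1 -> j (x + y) z = j x z + j y z.
Proof.
move=> degz; have [lin _ _] := jE.
by rewrite -[x in LHS]scale1r (lin (Sub z degz)) scale1r.
Qed.

Lemma interiorBl x y z : z \in degree Om 1 -> j (x - y) z = j x z - j y z.
Proof.
move=> degz; apply: (addIr (j y z)).
by rewrite -interiorDl // !subrK.
Qed.

(** In each degree [j] is an additive map [J] evaluated on elementary tensors, so additivity comes
    from [tensDr]; hence the reduction to homogeneous [x]. *)
Lemma interiorDr x y z : y \in degree Om 1 -> z \in degree Om 1 ->
  j x (y + z) = j x y + j x z.
Proof.
move=> degy degz; elim/degree_ind: x => [n x degx|x x' IHx IHx']; last first.
  by rewrite !interiorDl ?rpredD // IHx IHx' addrACA.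
have [_ /(_ n)[J [_ JE]] _] := jE.
have tensE u (degu : u \in degree Om 1) : j x u = J (tens (Sub x degx) (Sub u degu)).
  by rewrite JE.
rewrite (tensE y degy) (tensE z degz) -raddfD -tensDr JE.
by [].
Qed.

Lemma interior_degree n x z : x \in degree Om n -> z \in degree Om 1 ->
  degree_pred n (j x z).
Proof.
move=> degx degz; have [_ /(_ n)[J [degJ JE]] _] := jE.
by have := degJ (tens (Sub x degx) (Sub z degz)); rewrite JE.
Qed.

Lemma metric_degree w z : w \in degree Om 1 -> z \in degree Om 1 ->
  j w z \in degree Om 0.
Proof. exact: (@interior_degree 1). Qed.

Lemma interior_exact x a b : a \in degree Om 0 -> b \in degree Om 0 ->
  j x (a * diff Om b) = 2^-1 *: bracket E (x * a) b.
Proof.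
move=> dega degb; have degdb : a * diff Om b \in degree Om 1.
  exact: (degreeM dega (degree_diff degb)).
elim/degree_ind: x => [n x degx|x y IHx IHy]; last first.
  by rewrite interiorDl // IHx IHy mulrDl linearDl scalerDr.
by have [_ _ /(_ n (Sub x degx) (Sub a dega) (Sub b degb))] := jE.
Qed.

Lemma interior_scalel a x z : a \in degree Om 0 -> z \in degree Om 1 ->
  j (a * x) z = a * j x z.
Proof.
move=> dega; move: z; apply: (form1_ind std) => [b c degb degc|y z degy degz IHy IHz].
  by rewrite !interior_exact // -mulrA bracket_scalel // scalerAr.
by rewrite !interiorDr // IHy IHz mulrDr.
Qed.

Lemma interior_scaler a x z : a \in degree Om 0 -> z \in degree Om 1 ->
  j x (a * z) = a * j x z.
Proof.
move=> dega; move: z; apply: (form1_ind std) => [b c degb degc|y z degy degz IHy IHz].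
  rewrite mulrA !interior_exact //; last exact: (degreeM dega degb).
  by rewrite mulrA -(degree0_central x gc dega) -mulrA bracket_scalel // scalerAr.
by rewrite mulrDr !interiorDr ?IHy ?IHz ?mulrDr //; apply: (degreeM dega).
Qed.

Lemma interior_diff x b : b \in degree Om 0 -> j x (diff Om b) = nabla E x b.
Proof.
move=> degb; rewrite -[diff Om b]mul1r interior_exact ?mulr1 //.
exact: degree1.
Qed.

(** The cocycle equation with the function in the middle slot, combined with [w * a = a * w]. *)
Lemma bracket_leibnizr w a x : w \in degree Om 1 -> a \in degree Om 0 ->
  bracket E w (a * x) = a * bracket E w x + bracket E w a * x.
Proof.
move=> degw dega; have := bracketM E a x degw.
rewrite (bracket0 _ dega) !mulr0 addr0 => <-.
by rewrite -(degree0_central w gc dega) bracket_scalel.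
Qed.

Lemma nabla_leibniz w a x : w \in degree Om 1 -> a \in degree Om 0 ->
  nabla E w (a * x) = a * nabla E w x + j w (diff Om a) * x.
Proof.
move=> degw dega; rewrite interior_diff // /nabla bracket_leibnizr //.
by rewrite scalerDr scalerAr scalerAl.
Qed.

(** Two cocycle equations are combined, for [x, y, b] and for [x, b, y]: the second evaluates the
    bracket of [x] with [y * b = b * y] that occurs in the first. *)
Lemma bracket_leibnizl n x y b : x \in degree Om n -> b \in degree Om 0 ->
  bracket E (x * y) b = bracket E x b * y + (-1) ^+ n * (x * bracket E y b).
Proof.
move=> degx degb; apply: (addIr (bracket E x y * b)); rewrite (bracketM _ _ _ degx).
have := bracketM E b y degx; rewrite (bracket0 _ degb) !mulr0 addr0.
rewrite -!(degree0_central _ gc degb) bracket_scalel // => <-.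
by rewrite [RHS]addrC addrA.
Qed.

Lemma interior_leibniz n x y z : x \in degree Om n -> z \in degree Om 1 ->
  j (x * y) z = j x z * y + (-1) ^+ n * (x * j y z).
Proof.
move=> degx; move: z; apply: (form1_ind std) => [a b dega degb|z z' degz degz' IHz IHz'].
  have degdb := degree_diff degb.
  rewrite !interior_scaler // !interior_diff // /nabla (bracket_leibnizl _ degx) //.
  rewrite scalerDr mulrDr -[in RHS]mulrA -scalerAl; congr (_ + _).
  rewrite [in RHS](mulrA x) -(degree0_central x gc dega) -!scalerAr.
  by rewrite mulrA (commr_sign a) -!mulrA.
by rewrite !interiorDr // IHz IHz' mulrDl !mulrDr addrACA.
Qed.

(** * Symmetry of the metric, symmetric part of the covariant derivative, torsion *)

Lemma laplace_leibniz a x : a \in degree Om 0 ->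
  leibniz_defect (laplace E) a x = bracket E (diff Om a) x.
Proof.
move=> dega; rewrite (laplaceM E x dega) !(bracket0 _ dega).
by rewrite raddf0 add0r mulr0 addr0.
Qed.

Lemma bracket_diffC a b : a \in degree Om 0 -> b \in degree Om 0 ->
  bracket E (diff Om a) b = bracket E (diff Om b) a.
Proof.
move=> dega degb; rewrite -!laplace_leibniz // /leibniz_defect.
rewrite (degree0_central b gc dega) addrAC.
rewrite (degree0_central _ gc dega) -(degree0_central _ gc degb).
by [].
Qed.

Lemma metricC w z : w \in degree Om 1 -> z \in degree Om 1 -> j w z = j z w.
Proof.
move=> degw degz; move: w degw.
apply: (form1_ind std) => [a b dega degb|w w' degw degw' IHw IHw']; last first.
  by rewrite interiorDl // interiorDr // IHw IHw'.
have degdb := degree_diff degb.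
rewrite interior_scalel // interior_scaler //; congr (_ * _).
move: z degz; apply: (form1_ind std) => [c e degc dege|z z' degz degz' IHz IHz'].
  have degde := degree_diff dege.
  rewrite interior_scalel // interior_scaler // !interior_diff //.
  by rewrite /nabla bracket_diffC.
by rewrite interiorDl // interiorDr // IHz IHz'.
Qed.

Lemma diff_scale a x : a \in degree Om 0 ->
  diff Om (a * x) = diff Om a * x + a * diff Om x.
Proof. by move=> dega; rewrite (diffM x dega) expr0 mul1r. Qed.

Let symmetric_part w z :=
  nabla E w z + nabla E z w = j (diff Om w) z + j (diff Om z) w + diff Om (j w z).

(** Beyond the multiple by [a], the left side gains [(z, da) w]. On the right, [da (w, z)] appears
    with a minus sign from the graded derivation and with a plus sign from the exact term, leaving
    [(da, z) w]. *)
Lemma symmetric_part_scale a w z : a \in degree Om 0 ->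
    w \in degree Om 1 -> z \in degree Om 1 ->
  symmetric_part w z -> symmetric_part (a * w) z.
Proof.
move=> dega degw degz wz; have degda := degree_diff dega.
rewrite /symmetric_part nabla_scalel // nabla_leibniz // addrA -mulrDr wz.
rewrite !(interior_scalel _ dega) // interior_scaler // !(diff_scale _ dega).
rewrite interiorDl // (interior_scalel _ dega) // (interior_leibniz _ degda) //.
rewrite expr1 mulN1r.
rewrite (metricC degda) // !mulrDr [RHS]addrA [RHS](ACl (2*5*3*4*6*1))/=.
by rewrite addNr add0r.
Qed.

Lemma symmetric_part_diff a b : a \in degree Om 0 -> b \in degree Om 0 ->
  symmetric_part (diff Om a) (diff Om b).
Proof.
move=> dega degb; have [degda degdb] := (degree_diff dega, degree_diff degb).
have j0 z : z \in degree Om 1 -> j 0 z = 0.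
  by move=> degz; rewrite -[X in j X _](subrr 0) interiorBl // subrr.
rewrite /symmetric_part !diff_diff !j0 // !add0r interior_diff //.
(* Every bracket is now a Leibniz defect, and the claim reads [L(a, db) + L(b, da) = d L(a, b)]; it
   holds because the Laplacian commutes with [d]. *)
rewrite /nabla linearZ -scalerDr -!laplace_leibniz //; congr (_ *: _).
have [degLa degLb] := (degree_laplace E dega, degree_laplace E degb).
rewrite /leibniz_defect !raddfB /= -laplace_diff !diff_scale // raddfD /=.
rewrite !laplace_diff -!(degree0_central _ gc degb).
rewrite -(degree0_central (diff Om a) gc degLb).
by rewrite !opprD !addrA [LHS](ACl (4*1*6*2*5*3)).
Qed.

Lemma nabla_symmetric_part w z : w \in degree Om 1 -> z \in degree Om 1 ->
  nabla E w z + nabla E z w = j (diff Om w) z + j (diff Om z) w + diff Om (j w z).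
Proof.
have symD x y u : x \in degree Om 1 -> y \in degree Om 1 -> u \in degree Om 1 ->
    symmetric_part x u -> symmetric_part y u -> symmetric_part (x + y) u.
  move=> degx degy degu xu yu; rewrite /symmetric_part nablaDl nablaDr addrACA xu yu.
  rewrite raddfD !interiorDl // interiorDr // raddfD /=.
  by rewrite !addrA [LHS](ACl (1*4*2*5*3*6)).
(* Symmetry lets the reductions in the first argument serve for the second one. *)
have symC x y : x \in degree Om 1 -> y \in degree Om 1 ->
    symmetric_part x y -> symmetric_part y x.
  move=> degx degy xy; rewrite /symmetric_part addrC xy (metricC degx degy).
  by congr (_ + _); exact: addrC.
move=> degw degz; rewrite -/(symmetric_part w z); move: w degw.
apply: (form1_ind std) => [a b dega degb|w w' degw degw' IHw IHw']; last exact: symD.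
have degdb := degree_diff degb.
apply: symmetric_part_scale => //; apply: symC => //; move: z degz.
apply: (form1_ind std) => [c e degc dege|z z' degz degz' IHz IHz']; last exact: symD.
have degde := degree_diff dege.
by apply: symmetric_part_scale => //; exact: symmetric_part_diff.
Qed.

Lemma torsion_metric_compat w x z :
    w \in degree Om 1 -> x \in degree Om 1 -> z \in degree Om 1 ->
  torsion E j z w x + torsion E j z x w = metric_compat E j z w x.
Proof.
move=> degw degx degz; rewrite /torsion /metric_compat.
have degn u v : u \in degree Om 1 -> v \in degree Om 1 -> nabla E u v \in degree Om 1.
  exact: nabla_degree.
have degj u v : u \in degree Om 1 -> v \in degree Om 1 -> j (diff Om u) v \in degree Om 1.
  by move=> degu degv; exact: (interior_degree (degree_diff degu) degv).
have degdj : diff Om (j w x) \in degree Om 1.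
  exact: degree_diff (metric_degree degw degx).
(* The terms [j z (nabla w x)] and [j z (nabla x w)] are brought together; in their symmetric part
   the two contractions of [dw] and [dx] cancel the last terms of the torsions. *)
rewrite addrA addrA [LHS](ACl (1*4*3*6*5*2))/= -interiorDr ?degn //.
rewrite nabla_symmetric_part // !interiorDr ?rpredD ?degj //.
rewrite (metricC (degj _ _ degx degw) degz) (metricC (degj _ _ degw degx) degz).
rewrite (metricC (degn _ _ degz degw) degx).
by rewrite [LHS](ACl (3*2*4*1*5*6*7))/= !addrK.
Qed.

(** * The Hessian and the Laplace-Beltrami operator *)

Definition hessian w z x := nabla E w (nabla E z x) - nabla E (nabla E w z) x.

Lemma hessianDl v w z x : hessian (v + w) z x = hessian v z x + hessian w z x.
Proof. by rewrite /hessian !nablaDl opprD addrACA. Qed.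

Lemma hessianDr w y z x : hessian w (y + z) x = hessian w y x + hessian w z x.
Proof. by rewrite /hessian nablaDl !nablaDr nablaDl opprD addrACA. Qed.

(** Differentiating [a] produces [(w, da) nabla_z x] in both terms of the Hessian, and the
    difference cancels it. *)
Lemma hessian_balanced w a z x : w \in degree Om 1 -> a \in degree Om 0 ->
  hessian (w * a) z x = hessian w (a * z) x.
Proof.
move=> degw dega; have degda := degree_diff dega.
rewrite -(degree0_central w gc dega) /hessian !nabla_scalel //.
rewrite !nabla_leibniz // nablaDl !nabla_scalel //; last exact: metric_degree.
by rewrite [in RHS]opprD addrACA subrr addr0.
Qed.

(** Since [nabla_z a = (z, da)], the terms in which both derivatives fall on [a], together with the
    correction, make up [hessian w z a]; the cross terms remain. *)
Lemma hessian_leibniz w z a x :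
    w \in degree Om 1 -> z \in degree Om 1 -> a \in degree Om 0 ->
  hessian w z (a * x) = a * hessian w z x + hessian w z a * x
    + (j (diff Om a) w * nabla E z x + j (diff Om a) z * nabla E w x).
Proof.
move=> degw degz dega; have degda := degree_diff dega.
rewrite /hessian !nabla_leibniz ?nabla_degree // nablaDr !nabla_leibniz ?metric_degree //.
rewrite -!(interior_diff _ dega) -(interior_diff _ (metric_degree degz degda)).
rewrite !(metricC degda) // mulrBr mulrBl.
by rewrite opprD !addrA [LHS](ACl (1*5*4*6*2*3)).
Qed.

Lemma nabla_suml (I : Type) (s : seq I) (F : I -> Om) x :
  nabla E (\sum_(i <- s) F i) x = \sum_(i <- s) nabla E (F i) x.
Proof. by rewrite /nabla linear_sumlz scaler_sumr. Qed.

Lemma laplace_beltrami_leibniz (s : seq (dform Om 1 * dform Om 1)) a x :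
    (forall w : dform Om 1,
      \sum_(p <- s) j w p.1 * (p.2 : Om) = (w : Om) /\
      \sum_(p <- s) (p.1 : Om) * j p.2 w = (w : Om)) ->
    a \in degree Om 0 ->
  leibniz_defect (laplace_beltrami E s) a x = 2 *: nabla E (diff Om a) x.
Proof.
move=> inv_s dega; have degda := degree_diff dega.
have sum1 : \sum_(p <- s) j (diff Om a) p.1 * (p.2 : Om) = diff Om a.
  exact: (proj1 (inv_s (Sub (diff Om a) degda))).
have sum2 : \sum_(p <- s) (p.1 : Om) * j p.2 (diff Om a) = diff Om a.
  exact: (proj2 (inv_s (Sub (diff Om a) degda))).
have degp (w : dform Om 1) : dform_val w \in degree Om 1 by exact: valP.
(* Only the cross terms survive in the defect. Each half of the invertibility of the metric turns
   one of the two sums into [nabla_(da) x], whence the factor 2. *)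
have -> : leibniz_defect (laplace_beltrami E s) a x =
    \sum_(p <- s) j (diff Om a) p.1 * nabla E p.2 x
    + \sum_(p <- s) j (diff Om a) p.2 * nabla E p.1 x.
  rewrite /leibniz_defect [X in X - _ - _](_ : _ =
    \sum_(p <- s) hessian p.1 p.2 (a * x)) //.
  under eq_bigr => p _ do rewrite hessian_leibniz //.
  rewrite !big_split /= -mulr_sumr -mulr_suml.
  by rewrite !addrA [LHS](ACl (3*4*1*6*2*5))/= !addrK.
rewrite scaler_nat mulr2n; congr (_ + _).
  rewrite -[in RHS]sum1 nabla_suml; apply: eq_bigr => p _.
  by rewrite nabla_scalel // metric_degree.
rewrite -[in RHS]sum2 nabla_suml; apply: eq_bigr => p _.
have degj : j p.2 (diff Om a) \in degree Om 0 by exact: metric_degree.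
by rewrite -(degree0_central _ gc degj) nabla_scalel // (metricC degda).
Qed.

Lemma laplace_beltrami_tens (s t : seq (dform Om 1 * dform Om 1)) :
  tens_sum t = tens_sum s -> laplace_beltrami E t =1 laplace_beltrami E s.
Proof.
move=> ts x; apply: (balanced_sum_eq (f := fun w z : dform Om 1 => hessian w z x) _ _ _ ts).
- by move=> w w' z; exact: hessianDl.
- by move=> w z z'; exact: hessianDr.
- by move=> w a z; apply: hessian_balanced; exact: valP.
Qed.

(** * When the Ricci tensor is well defined *)

Section Ricci.
Variable s : seq (dform Om 1 * dform Om 1).
Hypothesis inv_s : forall w : dform Om 1,
  \sum_(p <- s) j w p.1 * (p.2 : Om) = (w : Om) /\
  \sum_(p <- s) (p.1 : Om) * j p.2 w = (w : Om).

Definition ricci_op x := laplace_beltrami E s x - laplace E x.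

Definition ricci_form (z : dform Om 1) : dform Om 1 :=
  Sub (ricci_op z) (ricci_subproof E s z).

(** The operator inside depends on [g] only, so it is frozen at [s] and just the outer sum varies
    with [t]. *)
Lemma ricciE (t : seq (dform Om 1 * dform Om 1)) : tens_sum t = tens_sum s ->
  ricci E t = \sum_(p <- t) tens p.1 (ricci_form p.2).
Proof.
move=> ts; apply: eq_bigr => p _; congr tens; apply: val_inj => /=.
by rewrite (laplace_beltrami_tens ts).
Qed.

Lemma ricci_op_leibniz a x : a \in degree Om 0 ->
  ricci_op (a * x) = a * ricci_op x + ricci_op a * x.
Proof.
move=> dega; have := laplace_beltrami_leibniz x inv_s dega.
rewrite two_half -laplace_leibniz // /leibniz_defect /ricci_op => eqL.
have -> : laplace_beltrami E s (a * x) = laplace E (a * x) - laplace E a * x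
    - a * laplace E x + a * laplace_beltrami E s x + laplace_beltrami E s a * x.
  by rewrite -eqL !subrK.
rewrite mulrBr mulrBl !addrA [LHS](ACl (4*3*5*2*(1*6)))/=.
by rewrite subrr addr0.
Qed.

Lemma ricci_formD (z z' : dform Om 1) :
  ricci_form (z + z') = ricci_form z + ricci_form z'.
Proof.
apply: val_inj; rewrite /= /ricci_op /laplace_beltrami.
under eq_bigr => p _ do rewrite -/(hessian _ _ _) /hessian !nablaDr opprD addrACA.
rewrite big_split /= raddfD /= opprD addrACA.
by [].
Qed.

Lemma ricci_definedP : ricci_defined E (tens_sum s) <->
  forall (a : dform Om 0) (w : dform Om 1), ricci_op a * (w : Om) = 0.
Proof.
have degp n (w : dform Om n) : dform_val w \in degree Om n by exact: valP.
split=> [[r ricci_r] a z | ricci0]; last first.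
  exists (ricci E s) => t ts; rewrite !ricciE //.
  apply: (balanced_sum_eq (f := fun w z : dform Om 1 => tens w (ricci_form z)) _ _ _ ts).
  - by move=> w w' z; exact: tensDl.
  - by move=> w z z'; rewrite ricci_formD tensDr.
  - move=> w a z; rewrite tensA; congr tens; apply: val_inj => /=.
    by rewrite ricci_op_leibniz // ricci0 addr0.
have tens_ricci (w y : dform Om 1) :
    tens (dform_rmul w a) (ricci_form y) = tens w (ricci_form (dform_lmul a y)).
  (* The added pairs represent the zero tensor, so [t] is another way of writing [g]. *)
  pose t := s ++ [:: (dform_rmul w a, y); (- w, dform_lmul a y)].
  have ts : tens_sum t = tens_sum s.
    by rewrite /tens_sum big_cat !big_cons big_nil /= tensNl tensA addr0 subrr addr0.
  have := ricci_r t ts; rewrite -(ricci_r s erefl) !ricciE //.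
  rewrite big_cat !big_cons big_nil /= tensNl addr0 -[RHS]addr0 => /addrI/eqP.
  by rewrite subr_eq0 => /eqP.
have rmulE (w : dform Om 1) (b : dform Om 0) :
    dform_val (dform_rmul w b) = (b : Om) * (w : Om).
  by rewrite (degree0_central _ gc).
(* Contracting the first tensor factor with [v] turns the equality of tensors into one of forms,
   where the Leibniz rule of [ricci_op] isolates the extra term. *)
have metric_ricci (v w y : dform Om 1) : j v w * (ricci_op a * (y : Om)) = 0.
  have ts : tens_sum [:: (dform_rmul w a, ricci_form y)] =
            tens_sum [:: (w, ricci_form (dform_lmul a y))].
    by rewrite /tens_sum !big_seq1 tens_ricci.
  have := balanced_sum_eq (f := fun u x : dform Om 1 => j v u * (x : Om)) _ _ _ ts.
  rewrite !big_seq1 /= => eq_j; apply: (addrI (j v w * ((a : Om) * ricci_op y))).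
  rewrite -mulrDr -ricci_op_leibniz // addr0 -eq_j => [|u u' x|u x x'|u b x].
  - by rewrite rmulE interior_scaler // (degree0_central (j v w) gc) // -mulrA.
  - by rewrite -mulrDl -interiorDr.
  - by rewrite -mulrDr.
  - by rewrite rmulE interior_scaler // (degree0_central (j v u) gc) // -mulrA.
(* With [z] written as the sum of [g1 (g2, z)], each summand is [metric_ricci] for [v = g2],
   [w = z], [y = g1]. *)
rewrite -[X in _ * X](proj2 (inv_s z)) mulr_sumr big1 // => p _.
have degj : j p.2 z \in degree Om 0 by exact: metric_degree.
by rewrite mulrA -(degree0_central _ gc degj) metric_ricci.
Qed.

End Ricci.

End CleftExtension.

Theorem proposition3p16 (k : fieldType) (hk : 2%N \notin [pchar k])
    (Om : dga k) (hOm : classical_type Om)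
    (E : cocycle Om) (hcleft : cleft E)
    (j : Om -> Om -> Om) (hj : interior_product E j) :
  [/\ forall w e : dform Om 1, j w e = j e w,
      forall z : dform Om 1, graded_derivation_pred (fun w : Om => j w z),
      forall w e : dform Om 1,
        nabla E w e + nabla E e w =
        j (diff Om (w : Om)) e + j (diff Om (e : Om)) w + diff Om (j w e),
      forall w e z : dform Om 1,
        torsion E j z w e + torsion E j z e w = metric_compat E j z w e &
      forall g : tensor_forms Om 1 1, invertible_with_metric j g ->
        exists LB : Om -> Om,
          [/\ forall s : seq (dform Om 1 * dform Om 1), tens_sum s = g ->
                laplace_beltrami E s =1 LB,
              forall (a : dform Om 0) (x : Om),
                leibniz_defect LB a x = 2 *: nabla E (diff Om (a : Om)) x,
              forall (a : dform Om 0) (x : Om),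
                leibniz_defect LB a x = leibniz_defect (laplace E) a x &
              ricci_defined E g <->
              (forall (a : dform Om 0) (w : dform Om 1),
                 (LB a - laplace E (a : Om)) * (w : Om) = 0)]].
Proof.
have [std gc _] := hOm.
have degp n (w : dform Om n) : dform_val w \in degree Om n by exact: valP.
split=> [w e|z|w e|w e z|g [s <- inv_s]].
- exact: (metricC std gc hcleft hj).
- split=> [|n x degx|n x y degx]; first by have [lin _ _] := hj; exact: lin.
    exact: (interior_degree hj).
  exact: (interior_leibniz std gc hcleft hj).
- exact: (nabla_symmetric_part std gc hcleft hj).
- exact: (torsion_metric_compat std gc hcleft hj).
have leibLB (a : dform Om 0) x :
    leibniz_defect (laplace_beltrami E s) a x = 2 *: nabla E (diff Om (a : Om)) x.
  exact: (laplace_beltrami_leibniz std gc hcleft hj x inv_s).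
(* The decomposition [s] supplied by invertibility defines the operator; any other one gives the
   same values. *)
exists (laplace_beltrami E s); split=> //.
- by move=> t; exact: (laplace_beltrami_tens gc hcleft hj).
- by move=> a x; rewrite leibLB (two_half hk) (laplace_leibniz hcleft).
- exact: (ricci_definedP hk std gc hcleft hj inv_s).
Qed.
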